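(* There exists a 3-connected non-complete planar graph that is not degree-truncated $9$-choosable. Consequently, $\operatorname{ch}^{*}(\mathcal{P}) \ge 10$, where $\mathcal{P}$ is the family of all 3-connected non-complete planar graphs and $\operatorname{ch}^{*}$ denotes the degree-truncated choice number.
   Context: Graphs are finite and simple. $d_G(v)$ is the degree of $v$ in $G$, and $\mathbb{N}=\{0,1,\ldots\}$. A list assignment $L$ of $G$ assigns a set $L(v)$ of permissible colours to each vertex $v$. An $L$-colouring of $G$ is a mapping $\phi$ with $\phi(v)\in L(v)$ for every vertex $v$ and $\phi(u)\neq\phi(v)$ for every edge $uv$. For $f:V(G)\to\mathbb{N}$, $G$ is $f$-choosable if $G$ has an $L$-colouring for every list assignment $L$ with $|L(v)|\ge f(v)$ for all $v\in V(G)$. For a positive integer $k$, $G$ is degree-truncated $k$-choosable if $G$ is $f$-choosable for $f(v)=\min\{k,d_G(v)\}$ ($v\in V(G)$). The degree-truncated choice number $\operatorname{ch}^{*}(G)$ (written in the paper as $\operatorname{ch}$ with a struck-through superscript d) is the minimum integer $k$ such that $G$ is degree-truncated $k$-choosable, and for a family $\mathcal{G}$ of graphs, $\operatorname{ch}^{*}(\mathcal{G})=\max\{\operatorname{ch}^{*}(G):G\in\mathcal{G}\}$. *)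

(* Defs.v *)
From mathcomp Require Import all_boot all_order all_algebra finmap.
From mathcomp Require Import all_classical all_reals all_analysis.

Set Implicit Arguments.
Unset Strict Implicit.
Unset Printing Implicit Defensive.

Import Order.TTheory GRing.Theory Num.Theory.
Import numFieldNormedType.Exports.

Local Open Scope ring_scope.

Record sgraph := SGraph {
  vertex :> finType;
  adj : rel vertex;
  adj_sym : symmetric adj;
  adj_irrefl : irreflexive adj }.

Definition degree (G : sgraph) (v : G) : nat := #|[pred w | adj v w]|.

Definition complete (G : sgraph) : Prop :=
  forall u v : G, u != v -> adj u v.

Definition delete_rel (G : sgraph) (X : {set G}) : rel G :=
  [rel x y | [&& x \notin X, y \notin X & adj x y]].

(* No separate nonemptiness requirement is needed on [G - X], since [k < #|G|]
   and [#|X| < k]. *)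
Definition k_connected (k : nat) (G : sgraph) : Prop :=
  (k < #|G|)%N /\
  forall X : {set G}, (#|X| < k)%N ->
    forall x y : G, x \notin X -> y \notin X -> connect (delete_rel X) x y.

Definition arc_between (R : realType) (A : set (R * R)) (x y : R * R) : Prop :=
  exists g : R -> R * R,
    [/\ {within `[0, 1], continuous g}%classic,
        {in `[0, 1] &, injective g},
        g 0 = x, g 1 = y & A = (g @` `[0, 1])%classic].

(* [pt] places the vertices in the plane and [arc [set u; v]] is the arc drawn
   for the edge [uv]; the values of [arc] on sets that are not edges are
   irrelevant. *)
Definition plane_drawing (R : realType) (G : sgraph)
    (pt : G -> R * R) (arc : {set G} -> set (R * R)) : Prop :=
  [/\ injective pt,
      forall u v : G, adj u v -> arc_between (arc [set u; v]) (pt u) (pt v),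
      forall u v w : G, adj u v -> arc [set u; v] (pt w) -> w = u \/ w = v
    & forall u v x y : G, adj u v -> adj x y -> [set u; v] != [set x; y] ->
        forall z : R * R, arc [set u; v] z -> arc [set x; y] z ->
          exists w : G, z = pt w].

Definition planar (R : realType) (G : sgraph) : Prop :=
  exists (pt : G -> R * R) (arc : {set G} -> set (R * R)),
    plane_drawing pt arc.

Definition list_colouring (G : sgraph) (C : choiceType)
    (L : G -> {fset C}) (phi : G -> C) : Prop :=
  (forall v : G, phi v \in L v) /\
  (forall u v : G, adj u v -> phi u <> phi v).

Definition choosable (G : sgraph) (f : G -> nat) : Prop :=
  forall (C : choiceType) (L : G -> {fset C}),
    (forall v : G, (f v <= #|` L v|)%N) ->
    exists phi : G -> C, list_colouring L phi.

Definition degree_truncated_choosable (k : nat) (G : sgraph) : Prop :=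
  choosable (fun v : G => minn k (degree v)).

(* The minimum of a set of positive integers, with value [+oo] when [G] is
   degree-truncated [k]-choosable for no [k], as happens for instance when [G]
   is a nonempty complete graph. *)
Definition dt_choice_number (R : realType) (G : sgraph) : \bar R :=
  ereal_inf [set (k%:R)%:E | k in
    [set k : nat | (0 < k)%N /\ degree_truncated_choosable k G]]%classic.

(* A supremum of elements of [nat] and [+oo] is the maximum whenever the latter
   exists. Families are plain predicates because [sgraph] is too large a type
   to be the domain of a classical [set]. *)
Definition dt_choice_number_family (R : realType) (P : sgraph -> Prop) :
    \bar R :=
  ereal_sup [set x : \bar R |
    exists2 G : sgraph, P G & x = dt_choice_number R G]%classic.

Definition three_connected_noncomplete_planar (R : realType) (G : sgraph) :
    Prop :=
  [/\ k_connected 3 G, ~ complete G & planar R G].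

(* Main.v *)
(** Two poles x and y with disjoint lists of nine colours are joined to every
    vertex of a path z_0, ..., z_485, and every triangle (pole, z_i, z_(i+1))
    contains a gadget: two triangles w0 t1 t2 and w0 s1 s2 sharing w0, with z_i
    adjacent to w0, t1, t2, with z_(i+1) adjacent to w0, s1, s2, and with the
    pole adjacent to t1, s1.  For disjoint triples T, T' and a colour c, give
    w0, t1, t2, s1, s2 the lists T u T', {c} u T, T, {c} u T', T', whose sizes
    are the degrees.  If the pole has colour c and z_i has a colour in T, then
    z_i, t1, t2 use up T; likewise z_(i+1), s1, s2 use up T' when z_(i+1) has a
    colour in T', and then nothing is left for w0.  Hence a gadget forbids a
    full box T x T' for the colours of (z_i, z_(i+1)) once its pole gets c.

    Six consecutive path vertices serve each of the 81 pairs (a, b) of pole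
    colours: their lists are {a, b} and seven further colours, and the two boxes
    on each of the five edges, together with properness, shrink the set of
    colours available at the successive vertices to sizes 7, 6, 4, 3, 1, 0. *)

Require Import Defs.
From mathcomp Require Import all_boot all_order all_algebra finmap.
From mathcomp Require Import all_classical all_reals all_analysis.
From mathcomp Require Import zify ring lra.

Set Implicit Arguments.
Unset Strict Implicit.
Unset Printing Implicit Defensive.

Import Order.TTheory GRing.Theory Num.Theory.
Import numFieldNormedType.Exports.

(** * Choosability and connectivity *)

Lemma choosable_mono (G : sgraph) (f g : G -> nat) :
  (forall v, f v <= g v)%N -> choosable f -> choosable g.
Proof.
by move=> lefg Gf C L Lg; apply: Gf => v; apply: leq_trans (lefg v) (Lg v).
Qed.

Lemma degree_truncated_choosable_mono (G : sgraph) (k l : nat) :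
  (k <= l)%N -> degree_truncated_choosable k G ->
    degree_truncated_choosable l G.
Proof.
move=> lekl; apply: choosable_mono => v.
by rewrite leq_min geq_minr (leq_trans (geq_minl _ _) lekl).
Qed.

(** By monotonicity no admissible [l] is at most [k], so [k + 1] bounds the infimum from below. *)
Lemma dt_choice_number_gt (R : realType) (G : sgraph) (k : nat) :
  ~ degree_truncated_choosable k G ->
  ((k.+1%:R)%:E <= dt_choice_number R G)%E.
Proof.
move=> nGk; apply/ereal_infP => _ [l [_ Gl] <-].
rewrite lee_fin ler_nat ltnNge; apply/negP => lelk.
exact/nGk/(degree_truncated_choosable_mono lelk).
Qed.

Lemma dt_choice_number_family_ge (R : realType) (P : sgraph -> Prop)
    (G : sgraph) :
  P G -> (dt_choice_number R G <= dt_choice_number_family R P)%E.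
Proof.
by move=> PG; apply: le_ereal_sup_tmp; exists (dt_choice_number R G) => //;
  exists G.
Qed.

(** * Three disjoint paths against two deleted vertices *)

Section Fans.

Variables (G : sgraph) (X : {set G}).
Hypothesis X_small : (#|X| < 3)%N.

Lemma uniq3_notin (a b c : G) : uniq [:: a; b; c] ->
  [|| a \notin X, b \notin X | c \notin X].
Proof.
move=> Us; rewrite -!negb_and; apply/negP => /and3P[aX bX cX].
move: X_small; rewrite ltnNge => /negP; apply.
have -> : 3 = size [:: a; b; c] by [].
rewrite cardE; apply: uniq_leq_size => // v.
by rewrite !inE mem_enum => /or3P[] /eqP->.
Qed.

Lemma delete_rel_sym : symmetric (delete_rel X).
Proof. by move=> u v; rewrite /delete_rel /= adj_sym andbCA. Qed.

Lemma delete_connectC u v :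
  connect (delete_rel X) u v = connect (delete_rel X) v u.
Proof. exact: (sym_connect_sym delete_rel_sym). Qed.

Lemma delete_connect1 u v :
  u \notin X -> v \notin X -> adj u v -> connect (delete_rel X) u v.
Proof.
by move=> uX vX uv; apply: connect1; rewrite /delete_rel /= uX vX uv.
Qed.

Lemma delete_connect_path u p :
  u \notin X -> ~~ has [in X] p -> path (@adj G) u p ->
  connect (delete_rel X) u (last u p).
Proof.
elim: p u => [|v p IHp] u uX //=; rewrite negb_or => /andP[vX pX] /andP[uv vp].
exact: connect_trans (delete_connect1 uX vX uv) (IHp v vX pX vp).
Qed.

(** If all three paths met [X], disjointness would make the three hits distinct, but [X] has at most
    two elements. *)
Lemma fan_connect u p1 p2 p3 : u \notin X ->
  path (@adj G) u p1 -> path (@adj G) u p2 -> path (@adj G) u p3 ->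
    uniq (p1 ++ p2 ++ p3) ->
  exists2 p, p \in [:: p1; p2; p3] &
    ~~ has [in X] p /\ connect (delete_rel X) u (last u p).
Proof.
move=> uX up1 up2 up3; rewrite !cat_uniq has_cat negb_or.
move=> /and3P[_ /andP[dis12 dis13] /and3P[_ dis23 _]].
have [/hasP[x1 p1x x1X]|p1X] := boolP (has [in X] p1); last first.
  by exists p1; [rewrite !inE eqxx | split=> //; exact: delete_connect_path].
have [/hasP[x2 p2x x2X]|p2X] := boolP (has [in X] p2); last first.
  by exists p2; [rewrite !inE eqxx orbT | split=> //;
    exact: delete_connect_path].
have [/hasP[x3 p3x x3X]|p3X] := boolP (has [in X] p3); last first.
  by exists p3; [rewrite !inE eqxx !orbT | split=> //;
    exact: delete_connect_path].
have neq y x (s t : seq G) : ~~ has [in s] t -> x \in s -> y \in t -> x != y.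
  by move=> /hasPn dis sx ty; apply: contraNneq (dis y ty) => <-.
have /uniq3_notin : uniq [:: x1; x2; x3].
  rewrite /= !inE negb_or !andbT.
  by rewrite (neq _ _ _ _ dis12) // (neq _ _ _ _ dis13) // (neq _ _ _ _ dis23).
by rewrite x1X x2X x3X.
Qed.

End Fans.

(** * The double fan with gadgets *)

(* Nodes 0, ..., 4 are w0, t1, t2, s1, s2; nodes 5, 6, 7 are the pole, z_i and
   z_(i+1). *)
Definition gadget_edges : seq (nat * nat) :=
  [:: (0, 1); (0, 2); (1, 2); (0, 3); (0, 4); (3, 4); (1, 5); (3, 5);
      (0, 6); (1, 6); (2, 6); (0, 7); (3, 7); (4, 7)].

Section DoubleFan.

Variable n : nat.

Definition double_fan_vertex : finType :=
  ((bool + 'I_n.+1) + (bool * 'I_n * 'I_5))%type.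

Definition pole (s : bool) : double_fan_vertex := inl (inl s).
Definition mid (i : 'I_n.+1) : double_fan_vertex := inl (inr i).
Definition inner (s : bool) (i : 'I_n) (k : 'I_5) : double_fan_vertex :=
  inr (s, i, k).

(** Numbering inner nodes and corners alike by naturals turns questions about a gadget into
    computations on [gadget_edges]. Only arguments below 8 are meaningful. *)
Definition node (s : bool) (i : 'I_n) (l : nat) : double_fan_vertex :=
  if (l < 5)%N then inner s i (inord l)
  else if l == 5 then pole s
  else if l == 6 then mid (inord i) else mid (inord i.+1).

(** Every edge is directed once: from pole to path, forwards along the path, and inside a gadget
    towards the larger number, so that a gadget arc starts at an inner node. *)
Definition double_fan_arc (u v : double_fan_vertex) : bool :=
  match u, v with
  | inl (inl _), inl (inr _) => true
  | inl (inr i), inl (inr j) => j == i.+1 :> nat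
  | inr (s, i, k), _ =>
    [exists l : 'I_8,
      ((k : nat, l : nat) \in gadget_edges) && (v == node s i l)]
  | _, _ => false
  end.

Definition double_fan_adj (u v : double_fan_vertex) : bool :=
  double_fan_arc u v || double_fan_arc v u.

Lemma double_fan_adj_sym : symmetric double_fan_adj.
Proof. by move=> u v; rewrite /double_fan_adj orbC. Qed.

Lemma gadget_edge_lt k l : (k, l) \in gadget_edges ->
  [/\ k < 5, l < 8 & k < l]%N.
Proof.
rewrite !inE => H; repeat case/orP: H => [/eqP[-> ->]//|H].
by case/eqP: H => -> ->.
Qed.

Lemma inner_node s i (k : 'I_5) : inner s i k = node s i k.
Proof. by rewrite /node ltn_ord inord_val. Qed.

Lemma double_fan_arc_innerP s i (k : 'I_5) v :
  reflect (exists2 l, (k : nat, l) \in gadget_edges & v = node s i l)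
          (double_fan_arc (inner s i k) v).
Proof.
apply: (iffP existsP) => [[l /andP[kl /eqP->]]|[l kl ->]];
  first by exists (val l).
have [_ l8 _] := gadget_edge_lt kl.
by exists (Ordinal l8); rewrite kl eqxx.
Qed.

Lemma node_inj s i : {in gtn 8 &, injective (node s i)}.
Proof.
have lt_i := ltn_ord i.
(* As [i < n], neither index overflows, so nodes 6 and 7 are two different path vertices. *)
have neqi : inord i != inord i.+1 :> 'I_n.+1.
  by apply/eqP => /(congr1 val); rewrite /= !inordK ?ltnS // ?(ltnW lt_i) //;
    lia.
move=> k l; rewrite !inE => k8 l8; rewrite /node.
have [k5|k5] := ltnP k 5; have [l5|l5] := ltnP l 5.
- by case=> /(congr1 val); rewrite /= !inordK.
- by case: ifP => // _; case: ifP.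
- by case: ifP => // _; case: ifP.
move: k k8 k5 => [|[|[|[|[|[|[|[|//]]]]]]]] // _ _;
move: l l8 l5 => [|[|[|[|[|[|[|[|//]]]]]]]] // _ _ //.
  by case=> E; rewrite E eqxx in neqi.
by case=> E; rewrite E eqxx in neqi.
Qed.

Lemma node_adj s i k l : (k, l) \in gadget_edges ->
  double_fan_adj (node s i k) (node s i l).
Proof.
move=> kl; have [k5 _ _] := gadget_edge_lt kl.
apply/orP; left; rewrite {1}/node k5; apply/double_fan_arc_innerP;
  exists l => //.
by rewrite inordK.
Qed.

Lemma double_fan_arc_irrefl : irreflexive double_fan_arc.
Proof.
move=> [[s|i]|[[s i] k]] //; first by rewrite /= ltn_eqF.
apply/negbTE/negP => /double_fan_arc_innerP[l kl].
have [k5 l8 ltkl] := gadget_edge_lt kl.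
rewrite -[inr _]/(inner s i k) inner_node => /node_inj E.
by rewrite E ?ltnn ?inE ?(ltn_trans k5) // in ltkl.
Qed.

Lemma double_fan_adj_irrefl : irreflexive double_fan_adj.
Proof. by move=> u; rewrite /double_fan_adj double_fan_arc_irrefl. Qed.

Definition double_fan : sgraph :=
  SGraph double_fan_adj_sym double_fan_adj_irrefl.

Lemma pole_mid_adj s i : double_fan_adj (pole s) (mid i).
Proof. by []. Qed.

Lemma mid_adj (i j : 'I_n.+1) : j = i.+1 :> nat ->
  double_fan_adj (mid i) (mid j).
Proof. by move=> ij; apply/orP; left; apply/eqP. Qed.

Lemma double_fan_adj_innerP s i (k : 'I_5) v : double_fan_adj (inner s i k) v ->
  exists2 l, (k : nat, l) \in gadget_edges \/ (l, k : nat) \in gadget_edges &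
             v = node s i l.
Proof.
case/orP=> [/double_fan_arc_innerP[l kl ->]|]; first by exists l => //; left.
case: v => [[//|//]|[[s' i'] k']] /double_fan_arc_innerP[l kl].
have [k5 _ _] := gadget_edge_lt kl.
rewrite /node; case: (ltnP l 5) => [l5|_]; last by case: ifP => // _; case: ifP.
case=> -> -> Ek; exists (val k'); last by rewrite ltn_ord inord_val.
by right; rewrite Ek inordK.
Qed.

Definition gadget_nbrs (k : nat) : seq nat :=
  [seq l <- iota 0 8 | ((k, l) \in gadget_edges) || ((l, k) \in gadget_edges)].

(** An upper bound suffices, since lists must be at least as long as the degree. *)
Lemma degree_inner s i (k : 'I_5) :
  (degree (inner s i k : double_fan) <= size (gadget_nbrs k))%N.
Proof.
rewrite -(size_map (node s i)) /degree cardE.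
apply: uniq_leq_size (enum_uniq _) _ => v;
  rewrite mem_enum inE => /double_fan_adj_innerP[l kl ->].
apply/map_f; rewrite mem_filter mem_iota /=.
case: kl => kl; rewrite kl ?orbT; first by have [] := gadget_edge_lt kl.
by apply: leq_trans (_ : 5 <= 8)%N => //; have [] := gadget_edge_lt kl.
Qed.

Lemma double_fan_not_complete : ~ complete double_fan.
Proof. by move=> /(_ (pole true) (pole false)) /(_ isT). Qed.

(** * 3-connectivity of the double fan *)

Section Connectivity.

Hypothesis n_ge2 : (1 < n)%N.
Variable X : {set double_fan}.
Hypothesis X_small : (#|X| < 3)%N.

Local Notation conn := (connect (delete_rel X)).
Local Notation rim j := (mid (inord j)).

Lemma rim_adj j : (j < n)%N -> double_fan_adj (rim j) (rim j.+1).
Proof. by move=> jn; apply: mid_adj; rewrite !inordK ?ltnS // ltnW. Qed.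

(** An inner vertex has paths to the three corners of its triangle that share only their start, and
    [X] cannot block all three. *)
Lemma inner_connect_outer u : u \notin X ->
  exists2 v : bool + 'I_n.+1, inl v \notin X & conn u (inl v).
Proof.
case: u => [v|[[s i] k]] uX; first by exists v => //; apply: connect0.
have fan (p1 p2 p3 : seq nat) :
    let P := map (node s i) in
    path (@adj double_fan) (node s i k) (P p1) ->
    path (@adj double_fan) (node s i k) (P p2) ->
    path (@adj double_fan) (node s i k) (P p3) ->
    uniq (p1 ++ p2 ++ p3) && all (gtn 8) (p1 ++ p2 ++ p3) ->
    all (fun p => 4 < last 0 p)%N [:: p1; p2; p3] ->
    exists2 v : bool + 'I_n.+1, inl v \notin X & conn (inr (s, i, k)) (inl v).
  rewrite -[inr _]/(inner s i k) inner_node in uX *.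
  move=> P kp1 kp2 kp3 /andP[Up /allP p8] lastp.
  have [|p'] := fan_connect X_small uX kp1 kp2 kp3.
    rewrite -!map_cat map_inj_in_uniq // => a b /p8 a8 /p8 b8; exact: node_inj.
  rewrite (_ : [:: P p1; P p2; P p3] = map P [:: p1; p2; p3]) //.
  case/mapP=> p /(allP lastp); case/lastP: p => [//|p l];
    rewrite last_rcons => l4 ->.
  rewrite /P map_rcons last_rcons has_rcons negb_or => -[/andP[lX _] kl].
  move: lX kl; rewrite /node ltnNge l4 /=.
  case: ifP => _; first by exists (inl s).
  by case: ifP => _; [exists (inr (inord i))|exists (inr (inord i.+1))].
have adjn a b : ((a, b) \in gadget_edges) || ((b, a) \in gadget_edges) ->
    double_fan_adj (node s i a) (node s i b).
  by case/orP=> /(node_adj s i) //; rewrite double_fan_adj_sym.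
move: fan; have := ltn_ord k; case: (k : nat) => [|[|[|[|[|//]]]]] _ fan.
(* The fans of the nodes 0 to 4 in turn. *)
- by apply: (fan [:: 6] [:: 7] [:: 1; 5]); rewrite //= ?adjn.
- by apply: (fan [:: 6] [:: 5] [:: 0; 7]); rewrite //= ?adjn.
- by apply: (fan [:: 6] [:: 1; 5] [:: 0; 7]); rewrite //= ?adjn.
- by apply: (fan [:: 7] [:: 5] [:: 0; 6]); rewrite //= ?adjn.
- by apply: (fan [:: 7] [:: 3; 5] [:: 0; 6]); rewrite //= ?adjn.
Qed.

Lemma pole_hub s (v : bool + 'I_n.+1) :
  pole s \notin X -> inl v \notin X -> conn (inl v) (pole s).
Proof.
have mid_hub s' i : pole s' \notin X -> mid i \notin X ->
    conn (mid i) (pole s').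
  by move=> sX iX; apply: delete_connect1 => //; rewrite adj_sym.
move=> sX; case: v => [s'|i] vX; last exact: mid_hub.
(* The other pole is reached through a surviving path vertex; [1 < n] provides three candidates. *)
have [j jX] : exists j, mid j \notin X.
  have : uniq [:: rim 0; rim 1; rim 2 : double_fan].
    rewrite (_ : [:: _; _; _] = [seq rim j | j <- [:: 0; 1; 2]]) //.
    rewrite map_inj_in_uniq // => a b a3 b3 [] /(congr1 val) /=.
    by rewrite !inordK //; move: a3 b3; rewrite !inE; lia.
  by move=> /(uniq3_notin X_small)/or3P[] ?; eexists; eassumption.
apply: connect_trans (mid_hub _ _ sX jX).
by rewrite delete_connectC; apply: mid_hub.
Qed.

(** The two poles already exhaust [X], so the path is intact. *)
Lemma poles_removed_connect i j :
  pole true \in X -> pole false \in X -> conn (mid i) (mid j).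
Proof.
move=> tX fX.
have midX k : mid k \notin X.
  apply/negP => kX.
  have := @uniq3_notin double_fan X X_small (pole true) (pole false) (mid k) isT.
  by rewrite tX fX kX.
suff to0 k : conn (mid k) (rim 0).
  by apply: connect_trans (to0 i) _; rewrite delete_connectC.
have rim0 m : (m <= n)%N -> conn (rim m) (rim 0).
  elim: m => [|m IHm] mn; first exact: connect0.
  apply: connect_trans (IHm (ltnW mn)); apply: delete_connect1 => //.
  by rewrite adj_sym; apply: rim_adj.
by rewrite -[k]inord_val; apply: rim0; rewrite -ltnS.
Qed.

Lemma double_fan_delete_connected u v : u \notin X -> v \notin X -> conn u v.
Proof.
move=> /inner_connect_outer[u' u'X uu'] /inner_connect_outer[v' v'X vv'].
apply: connect_trans uu' _; rewrite delete_connectC; apply: connect_trans vv' _.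
have hub s : pole s \notin X -> conn (inl v') (inl u').
  move=> sX; apply: connect_trans (pole_hub sX v'X) _.
  by rewrite delete_connectC; apply: pole_hub.
have [tX|/hub//] := boolP (pole true \in X).
have [fX|/hub//] := boolP (pole false \in X).
case: u' v' u'X v'X {hub} => [[]|i] [[]|j] //= uX vX;
  try by rewrite ?tX ?fX in uX vX.
exact: poles_removed_connect.
Qed.

End Connectivity.

Lemma double_fan_3connected : (1 < n)%N -> k_connected 3 double_fan.
Proof.
move=> n_ge2; split; last first.
  by move=> X X3 u v; apply: double_fan_delete_connected.
by rewrite /= card_sum card_sum !card_prod card_bool !card_ord; lia.
Qed.

End DoubleFan.

(** * Lists without a colouring *)

(* [palette m] holds the seven extra colours of the m-th vertex of a block of
   six, and [blockL s m], [blockR s m] are the triples T, T' of the gadget of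
   the pole s on the m-th edge.  The edge from one block to the next needs no
   gadget; it gets the default triples. *)
Definition palette (m : nat) : seq nat :=
  nth [::] [:: [:: 21; 22; 23; 24; 25; 26; 27];
               [:: 27; 28; 29; 30; 31; 32; 33];
               [:: 21; 22; 23; 24; 25; 26; 27];
               [:: 26; 27; 28; 29; 21; 22; 23];
               [:: 24; 25; 26; 27; 28; 29; 30];
               [:: 30; 21; 22; 23; 24; 25; 26]] m.

Definition blockL (s : bool) (m : nat) : seq nat :=
  nth [:: 21; 22; 23]
    (if s then [:: [:: 21; 22; 23]; [:: 28; 29; 30]; [:: 24; 25; 26];
                   [:: 21; 22; 23]; [:: 30; 31; 32]]
     else [:: [:: 24; 25; 26]; [:: 31; 32; 33]; [:: 27; 24; 25];
              [:: 21; 22; 23]; [:: 30; 31; 32]]) m.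

Definition blockR (s : bool) (m : nat) : seq nat :=
  nth [:: 24; 25; 26]
    (if s then [:: [:: 27; 28; 29]; [:: 21; 22; 23]; [:: 27; 28; 29];
                   [:: 24; 25; 26]; [:: 21; 22; 23]]
     else [:: [:: 27; 28; 29]; [:: 21; 22; 23]; [:: 26; 28; 29];
              [:: 27; 28; 29]; [:: 24; 25; 26]]) m.

Definition compatible (m c d : nat) : bool :=
  [&& c != d, ~~ ((c \in blockL true m) && (d \in blockR true m))
   & ~~ ((c \in blockL false m) && (d \in blockR false m))].

(** Constraints are propagated from the first vertex of a block: when the poles have the colours of
    the block, no colouring gives its [m]-th vertex a colour outside this list. *)
Fixpoint reachable (m : nat) : seq nat :=
  if m is m'.+1 then
    [seq d <- palette m | has (fun c => compatible m' c d) (reachable m')]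
  else palette 0.

Lemma reachable5 : reachable 5 = [::].
Proof. by vm_compute. Qed.

(** Pole colours run from 0 to 17, while palettes and triples start at 21, so they never meet. *)
Definition pole_list (s : bool) : seq nat := iota (if s then 0 else 9) 9.

(* The colours a and b that the block j excludes for the two poles. *)
Definition pole_colour (s : bool) (j : nat) : nat :=
  if s then j %/ 9 else 9 + j %% 9.

Definition mid_list (i : nat) : seq nat :=
  [:: pole_colour true (i %/ 6), pole_colour false (i %/ 6) & palette (i %% 6)].

Definition inner_list (s : bool) (i k : nat) : seq nat :=
  let c := pole_colour s (i %/ 6) in
  let T := blockL s (i %% 6) in let T' := blockR s (i %% 6) in
  nth [::] [:: T ++ T'; c :: T; T; c :: T'; T'] k.

Definition double_fan_list n (v : double_fan_vertex n) : seq nat :=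
  match v with
  | inl (inl s) => pole_list s
  | inl (inr i) => mid_list i
  | inr (s, i, k) => inner_list s i k
  end.

(** The 81 blocks of six make 486 path vertices, hence 485 path edges. *)
Lemma mid_list_ok : all (fun i =>
  uniq (mid_list i) && (size (mid_list i) == 9)) (iota 0 486).
Proof. by vm_compute. Qed.

Lemma inner_list_ok :
  all (fun i => all (fun k => all (fun s =>
    uniq (inner_list s i k) &&
    (size (gadget_nbrs k) <= size (inner_list s i k))%N)
    [:: true; false]) (iota 0 5)) (iota 0 485).
Proof. by vm_compute. Qed.

(** Since [t1] avoids [c], the distinct colours [t1], [t2], [p] all lie in [T] and fill it; [w]
    differs from each of them. *)
Lemma triangle_exhausts (C : eqType) (T : seq C) (c p w t1 t2 : C) :
  size T = 3 -> p \in T -> t1 \in c :: T -> t2 \in T -> t1 != c ->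
  uniq [:: t1; t2; p] -> w \notin [:: t1; t2; p] -> w \notin T.
Proof.
move=> T3 pT; rewrite inE => /orP[/eqP->|t1T] t2T; first by rewrite eqxx.
move=> _ Ut; apply: contraNN => wT.
have sub : {subset [:: t1; t2; p] <= T}.
  by move=> v; rewrite !inE => /or3P[] /eqP->.
by have [|_ ->] := uniq_min_size Ut sub; rewrite ?T3.
Qed.

(** * The effect of a gadget on a colouring *)

Section Colouring.

Variables (n : nat) (phi : double_fan n -> nat).
Hypothesis phiL : forall v, phi v \in double_fan_list v.
Hypothesis phi_proper : forall u v : double_fan n, adj u v -> phi u <> phi v.

Lemma node_neq s i k l : (k, l) \in gadget_edges ->
  phi (node s i k) != phi (node s i l).
Proof. by move=> kl; apply/eqP/phi_proper/node_adj. Qed.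

Lemma node_list s i k : (k < 5)%N -> phi (node s i k) \in inner_list s i k.
Proof.
move=> k5; have := phiL (node s i k).
by rewrite /node k5 /= inordK.
Qed.

Lemma gadget_kills s (i : 'I_n) : phi (pole _ s) = pole_colour s (i %/ 6) ->
  ~~ ((phi (mid (inord i)) \in blockL s (i %% 6)) &&
      (phi (mid (inord i.+1)) \in blockR s (i %% 6))).
Proof.
move=> sc.
(* Positions from 5 on take the default triples, which have length three as well. *)
have sz (m : nat) : (size (blockL s m) = 3) * (size (blockR s m) = 3).
  by case: s {sc}; case: m => [|[|[|[|[|[]]]]]].
have N := @node_neq s i; have L := @node_list s i.
apply/negP => /andP[pT qT'].
have w0 : phi (node s i 0) \in blockL s (i %% 6) ++ blockR s (i %% 6).
  exact: (L 0).
(* The colour of the shared vertex must lie in T or in T'; each of its two triangles rules out one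
   of them. *)
move: w0; rewrite mem_cat; apply/negP; rewrite negb_or; apply/andP; split.
- apply: (triangle_exhausts (sz _).1 pT (L 1 isT) (L 2 isT)).
  + by rewrite -sc; apply: (N 1 5).
  + by rewrite /= !inE negb_or (N 1 2) // (N 1 6) // (N 2 6).
  + by rewrite !inE !negb_or (N 0 1) // (N 0 2) // (N 0 6).
- apply: (triangle_exhausts (sz _).2 qT' (L 3 isT) (L 4 isT)).
  + by rewrite -sc; apply: (N 3 5).
  + by rewrite /= !inE negb_or (N 3 4) // (N 3 7) // (N 4 7).
  + by rewrite !inE !negb_or (N 0 3) // (N 0 4) // (N 0 7).
Qed.

End Colouring.

Lemma double_fan_not_colourable (phi : double_fan 485 -> nat) :
  (forall v, phi v \in double_fan_list v) ->
  ~ (forall u v : double_fan 485, adj u v -> phi u <> phi v).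
Proof.
move=> phiL phiP.
have := phiL (pole _ true); have := phiL (pole _ false); rewrite /= !mem_iota.
move=> /andP[b9 b18] /andP[_ a9].
set a := phi (pole _ true) in a9; set b := phi (pole _ false) in b9 b18.
(* The block, with index below 81, that serves the pair [(a, b)]: quotient and remainder by 9
   recover [a] and [b - 9]. *)
pose j := a * 9 + (b - 9).
have pj s : phi (pole _ s) = pole_colour s j.
  by case: s; rewrite /pole_colour -/a -/b /j; lia.
pose z m : 'I_486 := inord (6 * j + m).
have zE m : (m < 6)%N -> z m = 6 * j + m :> nat.
  by move=> m6; rewrite inordK //; lia.
have zdiv m : (m < 6)%N -> (6 * j + m) %/ 6 = j by lia.
have zmod m : (m < 6)%N -> (6 * j + m) %% 6 = m by lia.
(* Outside its palette, the list of [z m] holds only the colours of the two poles, both adjacent to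
   it. *)
have zpal m : (m < 6)%N -> phi (mid (z m)) \in palette m.
  move=> m6; have := phiL (mid (z m));
    rewrite /= /mid_list zE // zdiv // zmod // !inE.
  have/eqP/negbTE := phiP _ _ (pole_mid_adj true (z m)).
  have/eqP/negbTE := phiP _ _ (pole_mid_adj false (z m)).
  by rewrite !pj eq_sym => ->; rewrite eq_sym => ->.
have zcomp m : (m < 5)%N -> compatible m (phi (mid (z m))) (phi (mid (z m.+1))).
  move=> m5; have m6 : (m < 6)%N by lia.
  (* Here [j <= 80] and [m <= 4], so the edge has index at most 484 and carries gadgets. *)
  have lt485 : (6 * j + m < 485)%N by lia.
  have kills s : ~~ ((phi (mid (z m)) \in blockL s m) &&
    (phi (mid (z m.+1)) \in blockR s m)).
    have := @gadget_kills _ phi phiL phiP s (Ordinal lt485).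
    by rewrite /= zdiv // zmod // -addnS; apply; apply: pj.
  rewrite /compatible !kills !andbT; apply/eqP/phiP/mid_adj.
  by rewrite !zE // addnS.
have zreach m : (m < 6)%N -> phi (mid (z m)) \in reachable m.
  elim: m => [|m IHm] m6; first exact: zpal.
  rewrite /= mem_filter zpal // andbT; apply/hasP.
  by exists (phi (mid (z m))); [exact/IHm/ltnW | exact: zcomp].
by have := zreach 5 isT; rewrite reachable5.
Qed.

(** Poles and path vertices meet the bound 9, inner vertices the bound by the degree. Removing
    duplicates gives the cardinal of the finite set of colours. *)
Lemma double_fan_list_size (v : double_fan 485) :
  (minn 9 (degree v) <= size (undup (double_fan_list v)))%N.
Proof.
case: v => [[s|i]|[[s i] k]].
- by apply: leq_trans (geq_minl _ _) _; case: s.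
- apply: leq_trans (geq_minl _ _) _.
  have /allP/(_ (i : nat)) := mid_list_ok.
  by rewrite mem_iota ltn_ord => /(_ isT)/andP[/undup_id Ui /eqP sz];
    rewrite [double_fan_list _]/(mid_list i) Ui sz.
- apply: leq_trans (geq_minr _ _) _; apply: leq_trans (degree_inner _ _ _) _.
  have ii : (i : nat) \in iota 0 485 by rewrite mem_iota ltn_ord.
  have kk : (k : nat) \in iota 0 5 by rewrite mem_iota ltn_ord.
  have ss : s \in [:: true; false] by case: s.
  have /andP[/undup_id Uk le_k] :=
    allP (allP (allP inner_list_ok _ ii) _ kk) _ ss.
  by rewrite [double_fan_list _]/(inner_list s i k) Uk.
Qed.

Lemma double_fan_not_choosable :
  ~ degree_truncated_choosable 9 (double_fan 485).
Proof.
pose L (v : double_fan 485) := [fset c in double_fan_list v]%fset.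
case/(_ nat L) => [v|phi [phiL phiP]];
  first by rewrite card_fseq double_fan_list_size.
by apply: double_fan_not_colourable phiP => v; have := phiL v; rewrite inE.
Qed.

(** * Straight-line drawings *)

Local Open Scope ring_scope.

Section Segments.

Variable R : realType.
Implicit Types (p q : R * R) (t u : R).

Definition seg p q t : R * R :=
  ((1 - t) * p.1 + t * q.1, (1 - t) * p.2 + t * q.2).

Lemma seg0 p q : seg p q 0 = p.
Proof. by rewrite /seg subr0 !mul1r !mul0r !addr0 -surjective_pairing. Qed.

Lemma seg1 p q : seg p q 1 = q.
Proof. by rewrite /seg subrr !mul1r !mul0r !add0r -surjective_pairing. Qed.

Lemma seg_inj p q : p != q -> injective (seg p q).
Proof.
case: p q => [p1 p2] [q1 q2] pq t u [/= E1 E2].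
have F1 : (t - u) * (q1 - p1) = 0 by nra.
have F2 : (t - u) * (q2 - p2) = 0 by nra.
apply/eqP; rewrite -subr_eq0; apply: contraNT pq => tu.
move/eqP: F1; move/eqP: F2; rewrite !mulf_eq0 (negbTE tu) /= !subr_eq0.
by move=> /eqP-> /eqP->.
Qed.

Lemma seg_continuous p q : continuous (seg p q).
Proof.
have comp (a b t : R) :
    ((1 - x) * a + x * b @[x --> t] --> (1 - t) * a + t * b)%classic.
  apply: cvgD; apply: cvgM; try exact: cvg_cst; last exact: cvg_id.
  by apply: cvgB; [exact: cvg_cst | exact: cvg_id].
by move=> t; exact: (cvg_pair (comp p.1 q.1 t) (comp p.2 q.2 t)).
Qed.

Lemma seg_arc_between p q : p != q ->
  arc_between (seg p q @` `[0, 1])%classic p q.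
Proof.
move=> pq; exists (seg p q); split=> //.
- exact/continuous_subspaceT/seg_continuous.
- by move=> t u _ _; apply: seg_inj.
- exact: seg0.
- exact: seg1.
Qed.

End Segments.

(** Closed segments add only their ends, which are vertices, to the open ones, so testing open
    segments is enough. The relation [e] directs each edge once, lest an edge be compared with its
    own reversal. *)
Lemma straight_line_planar (R : realType) (G : sgraph) (e : rel G)
    (pt : G -> R * R) :
  (forall u v : G, adj u v = e u v || e v u) ->
  injective pt ->
  (forall (u v w : G) t, e u v -> 0 < t < 1 -> pt w != seg (pt u) (pt v) t) ->
  (forall (u v x y : G) t t', e u v -> e x y -> (u, v) != (x, y) ->
     0 < t < 1 -> 0 < t' < 1 -> seg (pt u) (pt v) t != seg (pt x) (pt y) t') ->
  planar R G.
Proof.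
move=> adjE pt_inj avoid disj.
have e_neq u v : e u v -> pt u != pt v.
  by rewrite inj_eq //; case: eqP => // ->; have := adj_irrefl v;
    rewrite adjE => /norP[/negP].
have segC p q : seg p q = seg q p \o (fun t : R => 1 - t).
  by apply/funext => t; rewrite /seg /=; congr pair; ring.
have segS (p q : R * R) :
    (seg p q @` `[0, 1] `<=` seg q p @` `[0, 1])%classic.
  move=> _ [t /= + <-]; rewrite in_itv /= [seg p q]segC => t01.
  by exists (1 - t); rewrite //= in_itv /=; lra.
have segI (p q : R * R) : (seg p q @` `[0, 1] = seg q p @` `[0, 1])%classic.
  by apply/seteqP; split; apply: segS.
(* Arcs are indexed by unordered pairs, so the definition ranges over the directed edges with the
   given end set; by [segI] the direction does not change the trace. *)
pose arc (A : {set G}) : set (R * R) := fun p => exists u v t,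
  [/\ e u v, A = [set u; v]%SET, 0 <= t <= 1 & p = seg (pt u) (pt v) t].
have pair_eq (u v x y : G) : [set u; v]%SET = [set x; y]%SET ->
    (x = u /\ y = v) \/ (x = v /\ y = u).
  move=> E; have := set21 u v; have := set22 u v; have := set21 x y;
    have := set22 x y.
  rewrite E -{1 2}E !inE.
  by do 4![case/orP=> /eqP ?]; subst; auto.
have arcE u v : e u v ->
    arc [set u; v]%SET = (seg (pt u) (pt v) @` `[0, 1])%classic.
  move=> uv; apply/seteqP; split; last first.
    by move=> _ [t /= + <-]; rewrite in_itv /= => t01; exists u, v, t.
  move=> p [x [y [t [xy /pair_eq E t01 ->]]]].
  have xyI : (seg (pt x) (pt y) @` `[0, 1])%classic (seg (pt x) (pt y) t).
    by exists t => //=; rewrite in_itv.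
  by case: E => -[xE yE]; rewrite xE yE in xyI *; rewrite // segI.
have ends (t : R) : 0 <= t <= 1 -> [\/ t = 0, t = 1 | 0 < t < 1].
  case/andP; rewrite !le_eqVlt => /orP[/eqP<-|t0]; first by constructor 1.
  by case/orP=> [/eqP->|t1]; [constructor 2 | constructor 3; rewrite t0].
exists pt, arc; split=> // [u v|u v w _ [x [y [t [xy E t01 pw]]]]|].
- rewrite adjE => /orP[] uv; first by rewrite arcE //;
    apply/seg_arc_between/e_neq.
  rewrite finset.setUC arcE // segI; apply: seg_arc_between.
  by rewrite eq_sym e_neq.
- have: w \in [set u; v]%SET.
    rewrite E !inE; case: (ends t t01) => t_e.
    + by move: pw; rewrite t_e seg0 => /pt_inj->; rewrite eqxx.
    + by move: pw; rewrite t_e seg1 => /pt_inj->; rewrite eqxx orbT.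
    + by move/eqP: pw; rewrite (negbTE (avoid _ _ _ _ xy t_e)).
  by rewrite !inE => /orP[] /eqP; auto.
- move=> u v x y _ _ neq z [u1 [v1 [t [uv E t01 zt]]]].
  move=> [x1 [y1 [t' [xy E' t01' zt']]]].
  case: (ends t t01) => [t_e|t_e|t_e].
  + by exists u1; rewrite zt t_e seg0.
  + by exists v1; rewrite zt t_e seg1.
  case: (ends t' t01') => [t_e'|t_e'|t_e'].
  + by exists x1; rewrite zt' t_e' seg0.
  + by exists y1; rewrite zt' t_e' seg1.
  move/eqP: zt; rewrite zt' eq_sym.
  rewrite (negbTE (disj _ _ _ _ _ _ uv xy _ t_e t_e')) //.
  by apply: contraNneq neq => -[ux vy]; rewrite E E' ux vy.
Qed.

(** * The drawing of the double fan *)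

(* Six times the barycentric weights of the nodes at the pole and at z_(i+1). *)
Definition node_coord (l : nat) : nat * nat :=
  nth (0, 6)%N [:: (1, 2); (2, 1); (1, 1); (3, 2); (2, 3); (6, 0); (0, 0)]%N l.

(** The orientation determinant, scaled by 36 to be an integer and hence computable. *)
Definition node_orient (e : nat * nat) (m : nat) : int :=
  let p := node_coord e.1 in let q := node_coord e.2 in let r := node_coord m in
  (q.1%:Z - p.1%:Z) * (r.2%:Z - p.2%:Z) - (q.2%:Z - p.2%:Z) * (r.1%:Z - p.1%:Z).

(** The ends of [f] lie in one closed half-plane of the line through [e], not both on the line, so
    the open segment [f] misses that line. *)
Definition same_side (e f : nat * nat) : bool :=
  (0 <= node_orient e f.1 * node_orient e f.2) &&
  ((node_orient e f.1 != 0) || (node_orient e f.2 != 0)).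

(** All gadgets are affine images of one picture, so a finite check of its pairs of edges is
    enough. *)
Lemma gadget_edges_disjoint :
  {in gadget_edges &, forall e f, e != f -> same_side e f || same_side f e}.
Proof.
suff /allP H : all (fun e => all (fun f =>
    (e == f) || same_side e f || same_side f e) gadget_edges) gadget_edges.
  by move=> e f /H/allP/[apply]; case: eqP.
by vm_compute.
Qed.

Lemma gadget_edge_off_node e m : e \in gadget_edges -> (m < 8)%N ->
  [|| m == e.1, m == e.2 | node_orient e m != 0].
Proof.
suff /allP H : all (fun e => all (fun m =>
    [|| m == e.1, m == e.2 | node_orient e m != 0]) (iota 0 8)) gadget_edges.
  by move=> /H/allP/(_ m); rewrite mem_iota.
by vm_compute.
Qed.

(** Node 7 takes the default [(0, 6)], its proper corner; larger numbers would repeat it. *)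
Lemma node_coord_inj : {in gtn 8 &, injective node_coord}.
Proof.
have U : uniq (map node_coord (iota 0 8)) by [].
move=> k l k8 l8 E; apply/eqP.
rewrite -(nth_uniq (0, 0)%N _ _ U) ?size_map ?size_iota //.
by rewrite !(nth_map 0%N) ?size_iota ?nth_iota //= E.
Qed.

Section Drawing.

Variable R : realType.
Implicit Types (p q r : R * R) (t : R).

Definition orient p q r : R :=
  (q.1 - p.1) * (r.2 - p.2) - (q.2 - p.2) * (r.1 - p.1).

Lemma orient_seg0 p q t : orient p q (seg p q t) = 0.
Proof. by rewrite /orient /seg /=; ring. Qed.

Lemma orient_seg p q r1 r2 t :
  orient p q (seg r1 r2 t) = (1 - t) * orient p q r1 + t * orient p q r2.
Proof. by rewrite /orient /seg /=; ring. Qed.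

(** At a common point a combination of the two orientations with positive weights vanishes; as their
    product is nonnegative, both would be zero. *)
Lemma seg_disjoint p q r1 r2 t t' :
  0 <= orient p q r1 * orient p q r2 ->
  (orient p q r1 != 0) || (orient p q r2 != 0) -> 0 < t' < 1 ->
  seg p q t != seg r1 r2 t'.
Proof.
move=> ab ab0 /andP[t0 t1]; apply: contraTneq ab0 => E.
have := orient_seg0 p q t; rewrite E orient_seg.
move: (orient p q r1) (orient p q r2) ab => a b ab abt.
(* Multiplying the relation by [a] and by [b] yields vanishing sums of nonnegative terms. *)
have a2 : (1 - t') * a ^+ 2 + t' * (a * b) = 0.
  by rewrite -[RHS](mulr0 a) -abt; ring.
have b2 : (1 - t') * (a * b) + t' * b ^+ 2 = 0.
  by rewrite -[RHS](mulr0 b) -abt; ring.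
have ta : 0 <= t' * (a * b) by rewrite mulr_ge0 // ltW.
have tb : 0 <= (1 - t') * (a * b) by rewrite mulr_ge0 // subr_ge0 ltW.
have ta2 : 0 <= (1 - t') * a ^+ 2 by rewrite mulr_ge0 ?sqr_ge0 // subr_ge0 ltW.
have tb2 : 0 <= t' * b ^+ 2 by rewrite mulr_ge0 ?sqr_ge0 // ltW.
have /eqP : (1 - t') * a ^+ 2 = 0 by lra.
have /eqP : t' * b ^+ 2 = 0 by lra.
rewrite !mulf_eq0 subr_eq0 (gt_eqF t0) (gt_eqF t1) /= !orbb.
by move=> /eqP-> /eqP->; rewrite eqxx.
Qed.

Definition node_pt (l : nat) : R * R :=
  ((node_coord l).1%:R / 6, (node_coord l).2%:R / 6).

Lemma orient_node_pt e m :
  orient (node_pt e.1) (node_pt e.2) (node_pt m) = (node_orient e m)%:~R / 36.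
Proof.
rewrite /orient /node_orient /node_pt /= !(rmorphB, rmorphM) /=.
by rewrite -!pmulrn; field.
Qed.

Lemma same_side_disjoint e f t t' : same_side e f -> 0 < t' < 1 ->
  seg (node_pt e.1) (node_pt e.2) t != seg (node_pt f.1) (node_pt f.2) t'.
Proof.
move=> /andP[ge0 neq0] t01; apply: seg_disjoint t01; rewrite !orient_node_pt.
  rewrite mulrACA -rmorphM /=; apply: mulr_ge0; first by rewrite ler0z.
  by rewrite -expr2 sqr_ge0.
have i36 : (36%:R : R)^-1 != 0 by rewrite invr_neq0 // pnatr_eq0.
by rewrite !mulf_eq0 !intr_eq0 (negbTE i36) !orbF.
Qed.

Lemma gadget_edge_seg_neq e f t t' : e \in gadget_edges -> f \in gadget_edges ->
  e != f -> 0 < t < 1 -> 0 < t' < 1 ->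
  seg (node_pt e.1) (node_pt e.2) t != seg (node_pt f.1) (node_pt f.2) t'.
Proof.
move=> eE fE ef t01 t01'; have /orP[] := gadget_edges_disjoint eE fE ef => side.
  exact: same_side_disjoint.
by rewrite eq_sym; apply: same_side_disjoint.
Qed.

Lemma node_pt_inj : {in gtn 8 &, injective node_pt}.
Proof.
move=> k l k8 l8 [/eqP E1 /eqP E2]; apply: node_coord_inj => //.
have six : (6%:R : R)^-1 != 0 by rewrite invr_eq0 pnatr_eq0.
move: E1 E2; rewrite !(inj_eq (mulIf six)) !eqr_nat => /eqP E1 /eqP E2.
by rewrite [LHS]surjective_pairing E1 E2 -surjective_pairing.
Qed.

Lemma node_pt_neq_seg e m t : e \in gadget_edges -> (m < 8)%N -> 0 < t < 1 ->
  node_pt m != seg (node_pt e.1) (node_pt e.2) t.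
Proof.
case: e => k l eE m8 /andP[t0 t1]; have [k5 l8 kl] := gadget_edge_lt eE.
have k8 : (k < 8)%N by apply: ltn_trans k5 _.
have neq : node_pt k != node_pt l by apply/eqP => /(node_pt_inj k8 l8); lia.
have /or3P[/eqP->|/eqP->|] := gadget_edge_off_node eE m8.
- by rewrite -{1}[node_pt _](seg0 _ (node_pt l)) (inj_eq (seg_inj neq)) lt_eqF.
- by rewrite -{1}[node_pt _](seg1 (node_pt k)) (inj_eq (seg_inj neq)) gt_eqF.
apply: contraNneq => E; have := orient_seg0 (node_pt k) (node_pt l) t.
rewrite -E (orient_node_pt (k, l)) => /eqP.
have i36 : (36%:R : R)^-1 != 0 by rewrite invr_neq0 // pnatr_eq0.
by rewrite mulf_eq0 intr_eq0 (negbTE i36) orbF.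
Qed.

(** * Placing the triangles in the plane *)

Definition side (s : bool) : R := if s then 1 else -1.

(* The affine map sending the standard triangle onto (pole s, z_i, z_(i+1)),
   where the poles are (0, 1) and (0, -1) and z_i = (i, 0). *)
Definition chart (s : bool) (i : nat) p : R * R :=
  (i%:R * (1 - p.1) + p.2, side s * p.1).

Lemma chart_inj s i : injective (chart s i).
Proof.
move=> [p1 p2] [q1 q2] [/=]; case: s; rewrite /side => E1 E2.
  have ? : p1 = q1 by lra.
  by subst; congr pair; apply: addrI E1.
have ? : p1 = q1 by lra.
by subst; congr pair; apply: addrI E1.
Qed.

Lemma chart_seg s i p q t :
  seg (chart s i p) (chart s i q) t = chart s i (seg p q t).
Proof. by rewrite /seg /chart /=; congr pair; ring. Qed.

Definition sign_of (y : R) : option bool :=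
  if 0 < y then Some true else if y < 0 then Some false else None.

(* The points of height |y| < 1 on the lines from a pole to z_i, for the last
   component [false], or strictly between the lines to z_i and z_(i+1), for
   [true]; distinct regions are disjoint, which settles all crossings except
   those inside one triangle. *)
Definition region (c : option bool * nat * bool) p : Prop :=
  let: (s, i, b) := c in
  [/\ sign_of p.2 = s, `|p.2| < 1 &
      if b then i%:R * (1 - `|p.2|) < p.1 < i.+1%:R * (1 - `|p.2|)
      else p.1 == i%:R * (1 - `|p.2|)].

(** At height [y] the lines from a pole cut the horizontal at the multiples of [h = 1 - |y| > 0], so
    the position of [p.1 / h] among the integers determines the label. *)
Lemma region_uniq c d p : region c p -> region d p -> c = d.
Proof.
case: c d p => [[c1 i] b] [[d1 j] b'] [x y] /= [<- y1 +] [<- _].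
have h0 : 0 < 1 - `|y| by rewrite subr_gt0.
move: (1 - `|y|) h0 => h h0; case: b; case: b'.
- move=> /andP[a1 a2] /andP[b1 b2].
  have := lt_trans a1 b2; have := lt_trans b1 a2.
  rewrite !(ltr_pM2r h0) !ltr_nat !ltnS => ij ji.
  by congr (_, _, _); apply/eqP; rewrite eqn_leq ij ji.
- move=> /andP[a1 a2] /eqP E; move: a1 a2; rewrite E !(ltr_pM2r h0) !ltr_nat;
    lia.
- move=> /eqP E /andP[a1 a2]; move: a1 a2; rewrite E !(ltr_pM2r h0) !ltr_nat;
    lia.
- move=> /eqP-> /eqP/(mulIf (lt0r_neq0 h0))/eqP; rewrite eqr_nat.
  by move=> /eqP->.
Qed.

Lemma norm_side s (a : R) : 0 <= a -> `|side s * a| = a.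
Proof. by case: s; rewrite /side ?mul1r ?mulN1r ?normrN => /ger0_norm. Qed.

Lemma sign_side s (a : R) : 0 < a -> sign_of (side s * a) = Some s.
Proof.
move=> a0; rewrite /sign_of /side.
by case: s; rewrite ?mul1r ?mulN1r ?oppr_gt0 ?oppr_lt0 a0 // ltNge ltW.
Qed.

(** The image of [(a, g)] has abscissa [i (1 - a) + g] with [0 < g < 1 - a]. *)
Lemma region_chart s i p : 0 < p.1 -> 0 < p.2 -> p.1 + p.2 < 1 ->
  region (Some s, i, true) (chart s i p).
Proof.
case: p => a g /= a0 g0 ag.
split; rewrite /= ?norm_side ?sign_side //; try exact: ltW; first by lra.
by rewrite -natr1; apply/andP; split; lra.
Qed.

Definition double_fan_pt n (v : double_fan_vertex n) : R * R :=
  match v with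
  | inl (inl s) => (0, side s)
  | inl (inr i) => (i%:R, 0)
  | inr (s, i, k) => chart s i (node_pt k)
  end.

(** The chart agrees with the global placement at the three corners, so every gadget edge is the
    image of a segment under one chart. *)
Lemma double_fan_pt_node n s (i : 'I_n) l : (l < 8)%N ->
  double_fan_pt (node s i l) = chart s i (node_pt l).
Proof.
move=> l8; rewrite /node; case: ltnP => [l5|]; first by rewrite /= inordK.
have i_n := ltn_ord i.
move: l l8 => [|[|[|[|[|[|[|[|//]]]]]]]] //= _ _; rewrite /chart /node_pt /=.
- by congr pair; field.
- by rewrite inordK ?ltnS 1?ltnW //; congr pair; field.
- by rewrite inordK ?ltnS //; rewrite -natr1; congr pair; field.
Qed.

Lemma node_pt_ge0 l : (0 <= (node_pt l).1) && (0 <= (node_pt l).2).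
Proof. by rewrite !divr_ge0. Qed.

Lemma node_pt_le1 l : (node_pt l).1 + (node_pt l).2 <= 1.
Proof.
have le6 : ((node_coord l).1 + (node_coord l).2 <= 6)%N.
  by move: l => [|[|[|[|[|[|[|l]]]]]]] //; rewrite /node_coord nth_default.
by rewrite -mulrDl -natrD ler_pdivrMr // mul1r ler_nat.
Qed.

Lemma node_pt_interior k : (k < 5)%N ->
  [/\ 0 < (node_pt k).1, 0 < (node_pt k).2 & (node_pt k).1 + (node_pt k).2 < 1].
Proof.
move=> k5; rewrite /node_pt /= -mulrDl -natrD ltr_pdivrMr // mul1r ltr_nat.
rewrite !divr_gt0 ?ltr0n //; last 2 first.
all: by move: k k5 => [|[|[|[|[|//]]]]].
Qed.

(** The region of the open segment of an arc; the last case is a placeholder. *)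
Definition arc_label n (u v : double_fan_vertex n) : option bool * nat * bool :=
  match u, v with
  | inl (inl s), inl (inr i) => (Some s, i : nat, false)
  | inl (inr i), _ => (None, i : nat, true)
  | inr (s, i, _), _ => (Some s, i : nat, true)
  | _, _ => (None, 0%N, false)
  end.

Lemma arc_region n (u v : double_fan_vertex n) t :
  double_fan_arc u v -> 0 < t < 1 ->
  region (arc_label u v) (seg (double_fan_pt u) (double_fan_pt v) t).
Proof.
case: u => [[s|i]|[[s i] k]].
- case: v => [[//|i]|//] _ /andP[t0 t1] /=.
  have yE : (1 - t) * side s + t * 0 = side s * (1 - t) by ring.
  have t1' : 0 < 1 - t by rewrite subr_gt0.
  split; rewrite /= yE ?norm_side ?sign_side ?ltW //; first by lra.
  by apply/eqP; ring.
- case: v => [[//|j]|//] /eqP ij /andP[t0 t1] /=.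
  have -> : (1 - t) * 0 + t * 0 = 0 :> R by ring.
  rewrite /sign_of ltxx normr0 subr0 !mulr1 ij -natr1; split=> //.
  by apply/andP; split; nra.
(* The tail is strictly inside the triangle and the head in its closure, so points with [t < 1] stay
   strictly inside. *)
- move=> /double_fan_arc_innerP[l kl ->] /andP[t0 t1].
  have [_ l8 _] := gadget_edge_lt kl.
  rewrite double_fan_pt_node // chart_seg; apply: region_chart.
  all: have [] := node_pt_interior (ltn_ord k); have := node_pt_ge0 l;
    have := node_pt_le1 l.
  all: rewrite /seg /=; move: (node_pt k) (node_pt l) =>
    [a b] [c d] /= ? /andP[? ?] ? ? ?.
  all: nra.
Qed.

Lemma pole_not_region n s c : ~ region c (double_fan_pt (pole n s)).
Proof.
case: c => [[c1 i] b] /= [_ + _].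
by case: s; rewrite /side ?normrN normr1 ltxx.
Qed.

(** Poles, at height 1 or -1, lie in no region and get a placeholder. *)
Definition vertex_label n (v : double_fan_vertex n) :
  option bool * nat * bool :=
  match v with
  | inl (inr i) => (None, i : nat, false)
  | inr (s, i, _) => (Some s, i : nat, true)
  | _ => (None, 0%N, false)
  end.

Lemma vertex_region n (v : bool + 'I_n.+1 + bool * 'I_n * 'I_5) :
  (forall s, v <> pole n s) -> region (vertex_label v) (double_fan_pt v).
Proof.
case: v => [[s /(_ s)//|i]|[[s i] k]] _ /=.
  by rewrite /sign_of ltxx normr0 subr0 mulr1.
by have [] := node_pt_interior (ltn_ord k); exact: region_chart.
Qed.

Lemma double_fan_pt_pole n s (v : double_fan_vertex n) :
  double_fan_pt v = double_fan_pt (pole n s) -> v = pole n s.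
Proof.
case: v => [[s'|i]|x] E.
- by case: E; case: s; case: s' => //; rewrite /side => ?; exfalso; lra.
- by case: (@pole_not_region n s (vertex_label (mid i))); rewrite -E;
    apply: vertex_region.
- by case: (@pole_not_region n s (vertex_label (inr x))); rewrite -E;
    apply: vertex_region.
Qed.

Lemma double_fan_pt_inj n : injective (@double_fan_pt n).
Proof.
move=> u v E.
have [[s us]|uNp] := pselect (exists s, u = pole n s).
  by rewrite us in E *; rewrite (double_fan_pt_pole (esym E)).
have [[s vs]|vNp] := pselect (exists s, v = pole n s).
  by rewrite vs in E *; rewrite (double_fan_pt_pole E).
have ur : region (vertex_label u) (double_fan_pt u).
  by apply: vertex_region => s us; apply: uNp; exists s.
have vr : region (vertex_label v) (double_fan_pt v).
  by apply: vertex_region => s vs; apply: vNp; exists s.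
rewrite -E in vr; have := region_uniq ur vr.
case: u v E uNp vNp {ur vr} =>
  [[s|i]|[[s i] k]] [[s'|j]|[[s' j] l]] E uNp vNp //=.
- by case: uNp; exists s.
- by case: uNp; exists s.
- by case: vNp; exists s'.
- by case=> /val_inj->.
- case=> ss /val_inj ij; rewrite -ss -ij in E *.
  have /node_pt_inj kl := chart_inj E; congr (inr (_, _, _)); apply: val_inj.
  by apply: kl; rewrite inE; [have := ltn_ord k | have := ltn_ord l]; lia.
Qed.

(** Comparing regions leaves only an inner vertex and a gadget edge of the same triangle, where the
    finite check applies. *)
Lemma double_fan_pt_neq_seg n (u v w : double_fan_vertex n) t :
  double_fan_arc u v -> 0 < t < 1 ->
  double_fan_pt w != seg (double_fan_pt u) (double_fan_pt v) t.
Proof.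
move=> uv t01; apply/eqP => E; have rw := arc_region uv t01; rewrite -E in rw.
have [[s ws]|wNp] := pselect (exists s, w = pole n s).
  by rewrite ws in rw; exact: pole_not_region rw.
have /(region_uniq rw) : region (vertex_label w) (double_fan_pt w).
  by apply: vertex_region => s ws; apply: wNp; exists s.
case: u uv E {rw} => [[s|i]|[[s i] k]].
- by case: v => [[//|i]|//] _ _; case: w wNp => [[s'|j]|[[s' j] k']] wNp //;
    case: wNp; exists s'.
- by case: v => [[//|j]|//] _ _; case: w wNp => [[s'|j']|[[s' j'] k']].
move=> /double_fan_arc_innerP[l kl ->];
  case: w wNp => [[s'|j]|[[s' j] k']] wNp E.
- by case: wNp; exists s'.
- by [].
case=> ss /val_inj ij; move: E; rewrite -ss -ij.
have [_ l8 _] := gadget_edge_lt kl.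
rewrite double_fan_pt_node // chart_seg => /chart_inj/eqP; apply/negP.
apply: (node_pt_neq_seg kl) => //.
by apply: leq_trans (ltn_ord k') _.
Qed.

(** The label determines a path edge or an edge from a pole to the path; two gadget edges with one
    label share a triangle and are compared in its chart. *)
Lemma double_fan_seg_neq n (u v x y : double_fan_vertex n) t t' :
  double_fan_arc u v -> double_fan_arc x y -> (u, v) != (x, y) ->
  0 < t < 1 -> 0 < t' < 1 ->
  seg (double_fan_pt u) (double_fan_pt v) t !=
  seg (double_fan_pt x) (double_fan_pt y) t'.
Proof.
move=> uv xy neq t01 t01'; apply/eqP => E.
have := arc_region xy t01'; rewrite -E => /(region_uniq (arc_region uv t01)).
case: u x uv xy neq E => [[s|i]|[[s i] k]] [[s'|j]|[[s' j] k']].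
- case: v y => [[//|i]|//] [[//|j]|//] _ _ neq _ [ss /val_inj ij].
  by rewrite ss ij eqxx in neq.
- by case: v y => [[//|i]|//] [[//|j']|//].
- by case: v y => [[//|i]|//] y _ _ _ _ [].
- by case: v y => [[//|i']|//] [[//|j']|//].
- case: v y => [[//|i']|//] [[//|j']|//] /eqP i1 /eqP j1 neq _ [/val_inj ij].
  by rewrite ij -j1 in i1; rewrite ij (val_inj i1) eqxx in neq.
- by case: v => [[//|i']|//].
- by case: y => [[//|i']|//] _ _ _ _ [].
- by case: y => [[//|i']|//].
move=> /double_fan_arc_innerP[l kl ->] /double_fan_arc_innerP[l' kl' ->].
move=> neq E [ss /val_inj ij]; move: neq E; rewrite -ss -ij => neq.
have [_ l8 _] := gadget_edge_lt kl; have [_ l8' _] := gadget_edge_lt kl'.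
rewrite !double_fan_pt_node // !chart_seg => /chart_inj/eqP; apply/negP.
apply: (gadget_edge_seg_neq kl kl') => //.
apply: contraNneq neq => -[/val_inj-> ->].
by rewrite eqxx.
Qed.

Lemma double_fan_planar n : planar R (double_fan n).
Proof.
apply: (@straight_line_planar R (double_fan n) (@double_fan_arc n)
  (@double_fan_pt n)) => //.
- exact: double_fan_pt_inj.
- exact: double_fan_pt_neq_seg.
- exact: double_fan_seg_neq.
Qed.

End Drawing.

Theorem mainTheorem1 (R : realType) :
  (exists G : sgraph,
     three_connected_noncomplete_planar R G /\ ~ degree_truncated_choosable 9 G) /\
  ((10%:R)%:E <=
     dt_choice_number_family R (three_connected_noncomplete_planar R))%E.
Proof.
have fanP : three_connected_noncomplete_planar R (double_fan 485).
  split; [exact: double_fan_3connected | exact: double_fan_not_complete |].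
  exact: double_fan_planar.
split.
  by exists (double_fan 485); split=> //; exact: double_fan_not_choosable.
apply: (le_trans (dt_choice_number_gt R double_fan_not_choosable)).
exact: dt_choice_number_family_ge.
Qed.
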